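(* Every $w_c$-$q_f$-space $X$ is $\mu^{\#}_{pc}$-complete; that is, every relatively pseudocompact subset of $C_p(X)$ has compact closure in $C_p(X)$.
   Context: All spaces are Tychonoff. $C_p(X)$ is the space of continuous real-valued functions on $X$ with the topology of pointwise convergence. A space is pseudocompact if every continuous real-valued function on it is bounded. A subset $Z$ of a space $T$ is relatively pseudocompact in $T$ if $Z\subset P\subset T$ for some pseudocompact subspace $P$; $Z$ is relatively countably compact in $T$ if every sequence in $Z$ has an accumulation point in $T$. A space $T$ is countably pracompact if it has a dense subset that is relatively countably compact in $T$. A space is weakly countably pracompact if it has a dense subspace that is a countable union of countably pracompact subspaces. $\mathcal P_c(X)$ is the family of all weakly countably pracompact subspaces of $X$. Subsets $A,B$ of $X$ are functionally separated if there is a continuous $g:X\to[0,1]$ with $g(A)\subset\{0\}$ and $g(B)\subset\{1\}$. The game $\Gamma(AV(X,x,A,\lambda),I_f)$: let $A\subset X$, $x\in\overline A\setminus A$, and let $\lambda$ be a cover of $X$. Two players $\alpha$ and $\beta$ play for countably many steps $n=0,1,2,\dots$. At step $n$, player $\beta$ chooses a neighborhood $V_n$ of $x$, then player $\alpha$ chooses $S_n\subset A$ such that $S_n\subset L$ for some $L\in\lambda$. Player $\alpha$ wins if there exists $S\subset\bigcap_n V_n$ such that $S\subset L$ for some $L\in\lambda$ and the sets $S$ and $\bigcup_n S_n$ are not functionally separated. Strategies may depend on all previous moves; the game is $\beta$-unfavorable if $\beta$ has no winning strategy. $X$ is a $w$-$q_f$-space with respect to $\lambda$ if for every discontinuous function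 $f:X\to\mathbb R$ there are a non-closed $A\subset X$ and a point $x\in\overline A\setminus A$ such that $f(x)\notin\overline{f(A)}$ and the game $\Gamma(AV(X,x,A,\lambda),I_f)$ is $\beta$-unfavorable. $X$ is a $w_c$-$q_f$-space if it is a $w$-$q_f$-space with respect to $\mathcal P_c(X)$. *)

(* Defs.v *)
From HB Require Import structures.
From mathcomp Require Import all_boot all_order all_algebra.
From mathcomp Require Import all_classical all_reals all_analysis.

Set Implicit Arguments.
Unset Strict Implicit.
Unset Printing Implicit Defensive.

Import Order.TTheory GRing.Theory Num.Theory.
Import numFieldNormedType.Exports.

Local Open Scope classical_set_scope.
Local Open Scope ring_scope.

(** The real line is an arbitrary [R : realType]. Properties of spaces are
    predicates on [topologicalType]; a subset [A : set T] regarded as a space is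
    the subtype [set_type A], with the topology induced by [T]. *)

(** [uniform_separatorP] identifies the separation used in
    [completely_regular_space] with separation by a continuous function into
    the unit interval. *)
Definition tychonoff_space (X : topologicalType) : Prop :=
  completely_regular_space X /\ hausdorff_space X.

Definition Cp (R : realType) (X : topologicalType) : topologicalType :=
  initial_topology (fun f : continuousType X R => (f : {ptws X -> R})).

Definition pseudocompact (R : realType) (T : topologicalType) : Prop :=
  forall f : T -> R, continuous f -> bounded_fun f.

Definition relatively_pseudocompact (R : realType) (T : topologicalType)
    (Z : set T) : Prop :=
  exists P : set T, Z `<=` P /\ pseudocompact R (set_type P).

Definition relatively_countably_compact (T : topologicalType)
    (Z : set T) : Prop :=
  forall u : nat -> T, (forall n, Z (u n)) -> cluster (u @ \oo) !=set0.

Definition countably_pracompact (T : topologicalType) : Prop :=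
  exists D : set T, dense D /\ relatively_countably_compact D.

Definition weakly_countably_pracompact (T : topologicalType) : Prop :=
  exists F : nat -> set T,
    dense (\bigcup_n F n) /\ forall n, countably_pracompact (set_type (F n)).

Definition Pc (X : topologicalType) : set (set X) :=
  [set L : set X | weakly_countably_pracompact (set_type L)].

Definition functionally_separated (R : realType) (X : topologicalType)
    (A B : set X) : Prop :=
  exists g : X -> R, [/\ continuous g, range g `<=` `[0, 1],
    g @` A `<=` [set 0] & g @` B `<=` [set 1]].

(** A play is given by the moves [V] of beta and the moves [S] of alpha. *)

Definition alpha_legal (X : topologicalType) (A : set X)
    (lam : set (set X)) (Sn : set X) : Prop :=
  Sn `<=` A /\ exists2 L, lam L & Sn `<=` L.

Definition alpha_wins (R : realType) (X : topologicalType)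
    (lam : set (set X)) (V S : nat -> set X) : Prop :=
  exists S' : set X, [/\ S' `<=` \bigcap_n V n,
    exists2 L, lam L & S' `<=` L &
    ~ functionally_separated R S' (\bigcup_n S n)].

(** A strategy of beta maps the finite list [(V_0, S_0), ..., (V_(n-1), S_(n-1))]
    of all previous moves of both players to the next neighborhood [V_n]. *)
Definition beta_strategy (X : topologicalType) (x : X)
    (sigma : seq (set X * set X) -> set X) : Prop :=
  forall h, nbhs x (sigma h).

Definition history (X : Type) (V S : nat -> set X) (n : nat) :
    seq (set X * set X) :=
  mkseq (fun k => (V k, S k)) n.

Definition beta_winning (R : realType) (X : topologicalType) (A : set X)
    (lam : set (set X)) (sigma : seq (set X * set X) -> set X) : Prop :=
  forall V S : nat -> set X,
    (forall n, V n = sigma (history V S n)) ->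
    (forall n, alpha_legal A lam (S n)) ->
    ~ alpha_wins R lam V S.

Definition beta_unfavorable (R : realType) (X : topologicalType) (x : X)
    (A : set X) (lam : set (set X)) : Prop :=
  ~ exists sigma, beta_strategy x sigma /\ beta_winning R A lam sigma.

Definition w_qf_space (R : realType) (X : topologicalType)
    (lam : set (set X)) : Prop :=
  forall f : X -> R, ~ continuous f ->
    exists (A : set X) (x : X),
      [/\ ~ closed A, (closure A `\` A) x, ~ closure (f @` A) (f x) &
          beta_unfavorable R x A lam].

Definition wc_qf_space (R : realType) (X : topologicalType) : Prop :=
  w_qf_space R (@Pc X).

Definition mu_pc_sharp_complete (R : realType) (X : topologicalType) : Prop :=
  forall Z : set (Cp R X),
    relatively_pseudocompact R Z -> compact (closure Z).

(** The game is only defined with respect to covers of [X]. *)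
Lemma Pc_cover (X : topologicalType) : \bigcup_(L in @Pc X) L = [set: X].
Proof.
have singleton_ccompact (T : topologicalType) (t : T) :
    (forall y : T, y = t) -> relatively_countably_compact [set: T].
  move=> Tt u _; exists t => B C [N _ uB] tC.
  exists (u N); split; first exact: (uB N (leqnn N)).
  by rewrite (Tt (u N)); exact: nbhs_singleton.
have dense_setT (T : topologicalType) : dense [set: T].
  by move=> O O0 _; rewrite setIT.
rewrite -subTset => x _; exists [set x] => //; exists (fun=> setT); split.
  by rewrite bigcup_const //; exact: dense_setT.
move=> n; exists setT; split; first exact: dense_setT.
have x1 : x \in [set x] by rewrite inE.
pose T := set_type [set: set_type [set x]].
have x2 : exist _ x x1 \in [set: set_type [set x]] by rewrite inE.
have := @singleton_ccompact T (exist _ (exist _ x x1) x2).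
apply => -[[y yx] yT]; apply: val_inj; apply: val_inj => /=.
by move: (yx); rewrite inE.
Qed.

(* Main.v *)
(** The closure of a pseudocompact [P] of [Cp X] in the product space [X -> R]
    consists of continuous functions. On countable sets, every [f] in this
    closure agrees with an element of [P]. Let [D] be relatively countably
    compact in [X]. Agreement on countable sets yields a double limit property
    for sequences of [P] and of [D]; hence nonempty open subsets of [P] contain
    nonempty open subsets of arbitrarily small uniform diameter over [D], and [f]
    is the limit on [D] of a sequence of such open sets. Pseudocompactness of [P]
    then gives an element of [P] that agrees with [f] on [D], and likewise on a
    countable union of such sets and on any set in its closure, hence on
    countable unions of elements of [Pc X]. If [f] were discontinuous, beta could
    win the game given by [f]: it plays neighborhoods of [x] defined by elements
    of [P] that agree with [f] on [x] and on all previous moves of alpha. *)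

Require Import Defs.
From mathcomp Require Import all_boot all_order all_algebra.
From mathcomp Require Import all_classical all_reals all_analysis.
From mathcomp Require Import lra.

Set Implicit Arguments.
Unset Strict Implicit.
Unset Printing Implicit Defensive.

Import Order.TTheory GRing.Theory Num.Theory.
Import numFieldNormedType.Exports.

Local Open Scope classical_set_scope.
Local Open Scope ring_scope.

(** * Basic neighborhoods for pointwise convergence *)

Section PointwiseConvergence.
Context {R : realType} {X : topologicalType}.
Implicit Types (P U W : set (X -> R)) (f g h : X -> R) (E : seq X) (e : R).

Definition close E e f g := forall x, x \in E -> `|f x - g x| < e.

(** Membership of [f] in the closure of [P] in the product [X -> R]; [f] itself may be
    discontinuous. *)
Definition approximable P f :=
  forall E e, 0 < e -> exists2 g, P g & close E e g f.

(** [h] is an accumulation point, in the product topology, of the sequence of sets [U]. *)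
Definition cluster_function (U : nat -> set (X -> R)) h :=
  forall E e N, 0 < e -> exists n g, [/\ (N <= n)%N, U n g & close E e g h].

Definition relatively_open P W := W `<=` P /\
  forall f, W f -> exists E e, 0 < e /\ forall g, P g -> close E e g f -> W g.

(** In a Tychonoff space this is equivalent to pseudocompactness. *)
Definition feebly_compact P := forall U : nat -> set (X -> R),
  (forall n, relatively_open P (U n) /\ U n !=set0) ->
  exists2 h, P h & cluster_function U h.

Definition bounded_at_points P :=
  forall x, exists M : R, forall g, P g -> `|g x| <= M.

Lemma closeS E1 E2 e1 e2 f g : {subset E1 <= E2} -> e2 <= e1 ->
  close E2 e2 f g -> close E1 e1 f g.
Proof. by move=> sE le21 fg x /sE /fg /lt_le_trans; apply. Qed.

Lemma close_refl E e f : 0 < e -> close E e f f.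
Proof. by move=> e0 x _; rewrite subrr normr0. Qed.

Lemma close_trans E e1 e2 f g h :
  close E e1 f g -> close E e2 g h -> close E (e1 + e2) f h.
Proof.
move=> fg gh x xE; rewrite -(subrKA (g x)).
by rewrite (le_lt_trans (ler_normD _ _))// ltrD ?fg ?gh.
Qed.

Lemma near_close T (F : set_system T) (G : T -> X -> R) f E e :
  Filter F -> (forall x, G t x @[t --> F] --> f x) -> 0 < e ->
  \forall t \near F, close E e (G t) f.
Proof.
move=> FF Gf e0; elim: E => [|x E IH]; first exact: nearW.
have /cvgrPdist_lt/(_ e e0) := Gf x; apply: filterS2 IH => s sE sx y.
by rewrite in_cons => /predU1P[->|/sE//]; rewrite distrC.
Qed.

Lemma relatively_openI P U W :
  relatively_open P U -> relatively_open P W -> relatively_open P (U `&` W).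
Proof.
move=> [UP oU] [WP oW]; split=> [f [/UP]//|f [Uf Wf]].
have [E1 [e1 [e10 E1U]]] := oU _ Uf; have [E2 [e2 [e20 E2W]]] := oW _ Wf.
exists (E1 ++ E2), (Num.min e1 e2); split; first by rewrite lt_min e10.
move=> g Pg gf; split; [apply: E1U => //|apply: E2W => //];
  apply: closeS gf => [x|]; rewrite ?ge_min ?lexx ?orbT// mem_cat => ->//.
by rewrite orbT.
Qed.

Lemma relatively_open_close P E e f :
  relatively_open P (P `&` [set g | close E e g f]).
Proof.
split=> [g []//|g [Pg]].
elim: E e => [|x E IH] e gf; first by exists [::], 1; split.
have [|E1 [e1 [e10 E1P]]] := IH e.
  by move=> y yE; apply: gf; rewrite in_cons yE orbT.
have gfx : 0 < e - `|g x - f x| by rewrite subr_gt0 gf// mem_head.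
exists (x :: E1), (Num.min e1 (e - `|g x - f x|)); split; first by rewrite lt_min e10.
move=> h Ph hg; split=> // y; rewrite in_cons => /predU1P[->|yE]; last first.
  apply: (E1P h Ph _).2 => //; apply: closeS hg => [z zE|]; rewrite ?ge_min ?lexx//.
  by rewrite in_cons zE orbT.
have := hg x (mem_head _ _); rewrite lt_min => /andP[_].
rewrite ltrBrDr; apply: le_lt_trans.
by rewrite -[h x - f x](subrKA (g x)) ler_normD.
Qed.

End PointwiseConvergence.

(** * Pseudocompact subsets of function spaces *)

Section Pseudocompact.
Context {R : realType} {X : topologicalType}.

Lemma Cp_eval_continuous (x : X) :
  continuous (fun g : Cp R X => (g : continuousType X R) x).
Proof.
move=> g; apply: (@continuous_comp (Cp R X) {ptws X -> R} R
  (fun g : continuousType X R => (g : {ptws X -> R})) (fun h => h x)).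
  exact: initial_continuous.
exact: (@proj_continuous X (fun=> R)).
Qed.

Lemma Cp_subspace_eval_continuous (P : set (Cp R X)) (x : X) :
  continuous (fun g : set_type P => (\val g : continuousType X R) x).
Proof.
move=> g; apply: (@continuous_comp (set_type P) (Cp R X) R
  (fun g => \val g) (fun g : Cp R X => (g : continuousType X R) x)).
  exact: (@initial_continuous _ _ set_val).
exact: Cp_eval_continuous.
Qed.

Definition functions_of (P : set (Cp R X)) : set (X -> R) :=
  [set ((f : continuousType X R) : X -> R) | f in P].

Lemma pseudocompact_bounded_at_points (P : set (Cp R X)) :
  pseudocompact R (set_type P) -> bounded_at_points (functions_of P).
Proof.
move=> cP x.
have [M [_ /(_ (M + 1))]] := cP _ (@Cp_subspace_eval_continuous P x).
rewrite ltrDl ltr01 => /(_ isT) PM.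
exists (M + 1) => _ [g Pg <-]; have Pg' : g \in P by rewrite inE.
exact: (PM (exist _ g Pg')).
Qed.


(* If no point of [P] is an accumulation point of the open sets [U n], then
   bump functions [phi n] of height [n] supported by [U n] form a locally
   finite family, whose sum is continuous and unbounded. *)
Lemma pseudocompact_feebly_compact (P : set (Cp R X)) :
  pseudocompact R (set_type P) -> feebly_compact (functions_of P).
Proof.
move=> cP U oU; apply: contrapT => noacc.
pose F (t : set_type P) : X -> R := (\val t : continuousType X R).
have cF x : continuous (F ^~ x) by exact: Cp_subspace_eval_continuous.
have FP t : functions_of P (F t) by exists (\val t) => //; exact: set_valP.
have [u Uu] := choice (fun n => (oU n).2).
have /choice[E] n := (oU n).1.2 _ (Uu n).
move=> /choice[d /all_and2[d0 EdU]].
have locfin (t : set_type P) :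
    exists N, \forall s \near t, forall n, (N <= n)%N -> ~ U n (F s).
  apply: contrapT => nN; apply: noacc; exists (F t) => // E' e N e0.
  apply: contrapT => nE; apply: nN; exists N.
  have := near_close E' (nbhs_filter t) (fun x => cF x t) e0.
  apply: filterS => s sE' n Nn UFs; apply: nE.
  by exists n, (F s).
have /choice[N FN] := locfin.
pose phi n t := n%:R * Num.max 0 (1 - (\sum_(x <- E n) `|F t x - u n x|) / d n).
have phi0 n t : 0 <= phi n t by rewrite mulr_ge0// le_max lexx.
have phiU n t : ~ U n (F t) -> phi n t = 0.
  move=> nU; apply/eqP; rewrite mulf_eq0; apply/orP; right.
  rewrite eq_maxl// subr_le0 ler_pdivlMr// mul1r leNgt.
  apply/negP => sd; apply: nU; apply: EdU => // x xE.
  apply: le_lt_trans sd; rewrite (big_rem x)//= lerDl; exact: sumr_ge0.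
have csum I (r : seq I) (G : I -> set_type P -> R) :
    (forall i, continuous (G i)) -> continuous (fun t => \sum_(i <- r) G i t).
  by move=> cG; apply: continuous_big => [|i _]; [exact: add_continuous|exact: cG].
have cphi n : continuous (phi n).
  move=> t.
  apply: (@continuousM R (set_type P) (cst n%:R)
    (cst 0 \max fun t => 1 - (\sum_(x <- E n) `|F t x - u n x|) / d n)).
    exact: cst_continuous.
  apply: continuous_max; first exact: cst_continuous.
  apply: (@continuousB R R^o (set_type P) (cst 1)); first exact: cst_continuous.
  apply: (@continuousM R (set_type P) _ (cst (d n)^-1)); last exact: cst_continuous.
  apply: (csum _ (E n) (fun x t => `|F t x - u n x|)) => x {}t.
  apply: (@continuous_comp _ R R (fun t => F t x - u n x) Num.norm).
    apply: (@continuousB R R^o _ _ (cst (u n x))); last exact: cst_continuous.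
    exact: cF.
  exact: (@norm_continuous _ R^o).
(* Past the cut-off [N t] given by local finiteness the partial sums at [t] are constant, so
   [S (N t) t] is the full sum. *)
pose S M t := \sum_(0 <= k < M) phi k t.
have SN t s M : (forall n, (N t <= n)%N -> ~ U n (F s)) -> (N t <= M)%N ->
    S M s = S (N t) s.
  move=> Nts NM; rewrite /S (big_cat_nat (leq0n (N t)) NM)//= [X in _ + X]big_nat.
  by rewrite [X in _ + X]big1 ?addr0// => k /andP[/Nts/phiU].
have SNt t M : (N t <= M)%N -> S M t = S (N t) t.
  by apply: SN; exact: nbhs_singleton (FN t).
have cS : continuous (fun t => S (N t) t).
  move=> t V tV; have SV : nbhs t (S (N t) @^-1` V) by exact: (csum _ _ _ cphi).
  move: (FN t) SV; apply: filterS2 => s sN /=.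
  rewrite -(SN t s (maxn (N s) (N t))) ?leq_maxr//.
  by rewrite SNt ?leq_maxl.
have [M [_ /(_ (M + 1))]] := cP _ cS.
rewrite ltrDl ltr01 => /(_ isT) SM.
have [n Mn] : exists n, M + 1 < n%:R :> R.
  exists (Num.bound `|M + 1|); apply: le_lt_trans (ler_norm _) _.
  exact: archi_boundP.
have [g Pg ug] := (oU n).1.1 _ (Uu n).
have Pg' : g \in P by rewrite inE.
pose t : set_type P := exist _ g Pg'.
have : `|S (N t) t| <= M + 1 by exact: SM.
rewrite -(SNt t (maxn (N t) n.+1)) ?leq_maxl//.
apply/negP; rewrite -ltNge; apply: lt_le_trans Mn _.
rewrite ger0_norm; last exact: sumr_ge0.
rewrite /S (big_rem n) /=; last by rewrite mem_index_iota leq_maxr.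
rewrite ler_wpDr//; first exact: sumr_ge0.
rewrite /phi big1; first by rewrite mul0r subr0 max_r ?mulr1.
by move=> x _; rewrite -ug subrr normr0.
Qed.

End Pseudocompact.

(** * The double limit property *)

Section DoubleLimit.
Context {R : realType} {X : topologicalType}.
Implicit Types (f g h : X -> R) (D : set X).

Lemma dist_triangle3 (a b c d : R) :
  `|a - b| <= `|a - c| + `|c - d| + `|d - b|.
Proof. exact: le_trans (ler_distD d _ _) (lerD (ler_distD c _ _) _). Qed.

Lemma dist_lt_eq (a b : R) : (forall e : R, 0 < e -> `|a - b| < e) -> a = b.
Proof.
move=> ab; apply/eqP; rewrite -subr_eq0 -normr_le0 leNgt; apply/negP => ab0.
by have := ab _ ab0; rewrite ltxx.
Qed.

(** A cluster point in the compact segment is a limit, since an ultrafilter contains each set or its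
    complement. *)
Lemma ultra_bounded_cvg T (U : set_system T) (u : T -> R) (M : R) :
  UltraFilter U -> U [set t | `|u t| <= M] -> exists a : R, u t @[t --> U] --> a.
Proof.
move=> UU UM.
have UI : U (u @^-1` `[- M, M]).
  by apply: (filterS _ UM) => t /=; rewrite in_itv/= ler_norml.
have [a [_ ua]] := @segment_compact R (- M) M (u t @[t --> U]) _ UI.
exists a => V /= aV; have [//|UV] := in_ultra_setVsetC (u @^-1` V) UU.
by have [b []] := ua (~` V) V UV aV.
Qed.

Lemma eventually_natSinv_lt (e : R) : 0 < e ->
  exists N, forall n, (N <= n)%N -> n.+1%:R^-1 < e.
Proof.
by move=> e0; have [N _ NP] := near_infty_natSinv_lt (PosNum e0); exists N.
Qed.

Lemma cluster_seq (d : nat -> X) y (V : set X) N :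
  cluster (d @ \oo) y -> nbhs y V -> exists2 n, (N <= n)%N & V (d n).
Proof.
move=> dy yV; have [|_ [[n /= Nn <-] Vdn]] := dy (d @` [set n | (N <= n)%N]) V _ yV.
  by exists N => // n /= Nn; exists n.
by exists n.
Qed.

Lemma cluster_seq_dist (d : nat -> X) y h (e : R) N : continuous h ->
  cluster (d @ \oo) y -> 0 < e -> exists2 n, (N <= n)%N & `|h (d n) - h y| < e.
Proof.
move=> ch dy e0; have /cvgrPdist_lt/(_ e e0) := ch y.
by move=> /(cluster_seq N dy)[n Nn]; rewrite distrC; exists n.
Qed.

(** Continuity of [h] at a cluster point of [d] bounds infinitely many [h (d n)] by one constant,
    which large [n] exceed. *)
Lemma relatively_countably_compact_bounded D h :
  relatively_countably_compact D -> continuous h ->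
  forall d : nat -> X, (forall n, D (d n)) -> exists n, `|h (d n)| <= n%:R.
Proof.
move=> cD ch d Dd; have [y dy] := cD d Dd.
have [n] := cluster_seq_dist (Num.bound (`|h y| + 1)) ch dy ltr01.
rewrite -(ler_nat R) => hn hd; exists n; apply: le_trans hn.
have /ltW : `|h y| + 1 < (Num.bound (`|h y| + 1))%:R.
  by apply: archi_boundP; rewrite addr_ge0.
apply: le_trans; rewrite -(subrK (h y) (h (d n))) addrC.
by rewrite (le_trans (ler_normD _ _))// lerD2l ltW.
Qed.

Variable P : set (X -> R).
Hypotheses (Pcont : forall g, P g -> continuous g) (Pfc : feebly_compact P).
Hypothesis Pbd : bounded_at_points P.

(** Feeble compactness is applied to shrinking traces on [P] of neighborhoods of [f] at the first
    [n] points of [c]; any accumulation point has the values of [f] there. *)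
Lemma approximable_countable f (c : nat -> X) : approximable P f ->
  exists2 h, P h & forall n, h (c n) = f (c n).
Proof.
move=> Pf; pose E n := [seq c k | k <- iota 0 n].
have [n|h Ph hU] := Pfc (U := fun n => P `&` [set g | close (E n) n.+1%:R^-1 g f]).
  split; first exact: relatively_open_close.
  by have [|g] := Pf (E n) n.+1%:R^-1; [rewrite invr_gt0|exists g].
exists h => // k; apply: dist_lt_eq => e e0.
have e20 : 0 < e / 2 by rewrite divr_gt0.
have [N NP] := eventually_natSinv_lt e20.
have [n [g [+ [_ gf] gh]]] := hU [:: c k] _ (maxn N k.+1) e20.
rewrite geq_max => /andP[Nn kn].
have gfk : `|g (c k) - f (c k)| < n.+1%:R^-1.
  by apply: gf; apply: map_f; rewrite mem_iota add0n.
have := gh (c k) (mem_head _ _); have := NP n Nn; move: gfk; rewrite !ltr_norml.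
by move: n.+1%:R^-1 => ?; lra.
Qed.

Lemma approximable_cons f (c : nat -> X) y : approximable P f ->
  exists h, [/\ P h, h y = f y & forall n, h (c n) = f (c n)].
Proof.
pose c' n := if n is k.+1 then c k else y.
move=> /(approximable_countable c')[h Ph hf].
by exists h; split=> // [|n]; [exact: hf 0%N|exact: hf n.+1].
Qed.

(** Pointwise bounds give a limit along an ultrafilter finer than [\oo]. It lies in the closure of
    [P], perhaps not in [P]. *)
Lemma accumulation_exists (g : nat -> X -> R) : (forall n, P (g n)) ->
  exists f, approximable P f /\ cluster_function (fun n => [set g n]) f.
Proof.
move=> Pg; have [U [UU ooU]] := ultraFilterLemma eventually_filter.
have /choice[f gf] x : exists a : R, g n x @[n --> U] --> a.
  have [M PM] := Pbd x.
  have UI : U [set n | `|g n x| <= M] by apply: filterE => n; exact: PM.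
  exact: ultra_bounded_cvg UI.
have acc : cluster_function (fun n => [set g n]) f.
  move=> E e N e0.
  have UN : U [set n | (N <= n)%N] by apply: ooU; exists N.
  have [n [Nn gn]] := filter_ex (filterI UN (near_close E _ gf e0)).
  by exists n, (g n).
exists f; split=> // E e e0.
by have [n [_ [_ -> ge]]] := acc E e 0%N e0; exists (g n).
Qed.

Lemma approximable_bounded f D : relatively_countably_compact D ->
  approximable P f -> exists M : R, forall x, D x -> `|f x| <= M.
Proof.
move=> cD Pf; apply: contrapT => /forallNP nM.
have /choice[d] n : exists x, D x /\ n%:R < `|f x|.
  have /existsNP[x /not_implyP[Dx /negP]] := nM n%:R.
  by rewrite -ltNge; exists x.
move=> /all_and2[Dd fd]; have [h Ph hf] := approximable_countable d Pf.
have [n] := relatively_countably_compact_bounded cD (Pcont Ph) Dd.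
by rewrite hf leNgt fd.
Qed.

(* A limit of the [g i] cannot separate the [d n] from the [d' n] more than all
   the [g i] do: cluster points of both sequences are not separated by the
   [g i], hence not by [f], which agrees with elements of [P] on countable
   sets. *)
Lemma double_limit D (g : nat -> X -> R) f (d d' : nat -> X) (e : R) :
  relatively_countably_compact D -> (forall i, P (g i)) ->
  approximable P f -> cluster_function (fun i => [set g i]) f ->
  (forall n, D (d n)) -> (forall n, D (d' n)) ->
  (forall i (e : R), 0 < e ->
    exists N, forall n, (N <= n)%N -> `|g i (d n) - g i (d' n)| < e) ->
  0 < e -> exists n, `|f (d n) - f (d' n)| < e.
Proof.
move=> cD Pg Pf gf Dd Dd' dd' e0.
have [y dy] := cD d Dd.
have [h [Ph hy hd]] := approximable_cons d y Pf.
(* Along the indices [s k] the values of [h] and of every [g i] converge to those at [y]; [G] puts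
   [h] before the [g i] so that one neighborhood handles all. *)
have /choice[s sP] k : exists n, [/\ (k <= n)%N, `|h (d n) - h y| < k.+1%:R^-1 &
    forall i, (i < k)%N -> `|g i (d n) - g i y| < k.+1%:R^-1].
  have k0 : 0 < k.+1%:R^-1 :> R by rewrite invr_gt0.
  pose G z i := if i is j.+1 then g j z else h z.
  have cG i : continuous (G ^~ i) by case: i => [|i] /=; exact: Pcont.
  have : \forall z \near y, forall i, i \in iota 0 k.+1 ->
      `|G z i - G y i| < k.+1%:R^-1.
    apply: (near_close (X := nat)) => // i; exact: cG.
  move=> /(cluster_seq k dy)[n kn Gn]; exists n; split=> //.
    by apply: (Gn 0%N); rewrite mem_iota.
  by move=> i ik; apply: (Gn i.+1); rewrite mem_iota add0n ltnS.
have [y' dy'] := cD (d' \o s) (fun k => Dd' (s k)).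
have gy i : g i y = g i y'.
  apply: dist_lt_eq => r r0; have r30 : 0 < r / 3 by rewrite divr_gt0.
  have [N1 N1P] := dd' i _ r30; have [N2 N2P] := eventually_natSinv_lt r30.
  have [k] := cluster_seq_dist (maxn i.+1 (maxn N1 N2)) (Pcont (Pg i)) dy' r30.
  rewrite !geq_max /= => /and3P[ik N1k N2k].
  have [ks _ /(_ i ik)] := sP k.
  have := N1P _ (leq_trans N1k ks); have := N2P _ N2k.
  by rewrite /= !ltr_norml; move: k.+1%:R^-1 => ?; lra.
have fy : f y = f y'.
  apply: dist_lt_eq => r r0; have r20 : 0 < r / 2 by rewrite divr_gt0.
  have [n [_ [_ -> gfn]]] := gf [:: y; y'] _ 0%N r20.
  have := gfn y (mem_head _ _); have := gfn y'.
  rewrite gy in_cons mem_head orbT => /(_ isT); rewrite !ltr_norml; lra.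
have [h' [Ph' hy' hd']] := approximable_cons d' y' Pf.
have e20 : 0 < e / 2 by rewrite divr_gt0.
have [N NP] := eventually_natSinv_lt e20.
have [k Nk /=] := cluster_seq_dist N (Pcont Ph') dy' e20.
rewrite hy' hd' -fy => fd'; exists (s k).
have [_ + _] := sP k; move: fd' (NP k Nk); rewrite hy hd !ltr_norml.
by move: k.+1%:R^-1 => ?; lra.
Qed.

End DoubleLimit.

(** * Finite nets for finitely many bounded functions *)

Section FiniteNet.
Context {R : realType} {T : eqType}.

(** Induction on the list: the range of the first function is cut into finitely many intervals of
    length [e], and each part of [D] with values in one interval gets its own net. *)
Lemma finite_net (gs : seq (T -> R)) (D : set T) (e : R) :
  (forall g, g \in gs -> exists M : R, forall x, D x -> `|g x| <= M) -> 0 < e ->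
  exists E : seq T, (forall x, x \in E -> D x) /\
    forall x, D x -> exists2 y, y \in E & forall g, g \in gs -> `|g x - g y| < e.
Proof.
move=> + e0; elim: gs D => [|g gs IH] D bd.
  have [[x Dx]|D0] := pselect (D !=set0).
    exists [:: x]; split=> [y|y Dy]; first by rewrite inE => /eqP->.
    by exists x; rewrite ?mem_head.
  by exists [::]; split=> // x Dx; exfalso; apply: D0; exists x.
have [M gM] := bd g (mem_head _ _).
pose cell x := Num.truncn ((g x + M) / e).
have cellP x : D x -> (cell x)%:R <= (g x + M) / e < (cell x).+1%:R.
  move=> Dx; apply: truncn_itv; apply: divr_ge0; last exact: ltW.
  by have := gM x Dx; rewrite ler_norml => /andP[]; lra.
have /choice[E /all_and2[ED Enet]] k : exists E : seq T,
    (forall x, x \in E -> D x /\ cell x = k) /\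
    forall x, D x -> cell x = k ->
      exists2 y, y \in E & forall g, g \in gs -> `|g x - g y| < e.
  have [g' g'gs|E [ED Enet]] := IH [set x | D x /\ cell x = k].
    have [|M' M'P] := bd g'; first by rewrite in_cons g'gs orbT.
    by exists M' => x [/M'P].
  by exists E; split=> // x Dx xk; exact: Enet.
exists (flatten [seq E k | k <- iota 0 (Num.truncn (2 * M / e)).+1]); split.
  by move=> x /flattenP[_ /mapP[k _ ->]] /ED[].
move=> x Dx; have [y yE gy] := Enet (cell x) x Dx erefl.
exists y.
  apply/flattenP; exists (E (cell x)) => //; apply: map_f.
  rewrite mem_iota add0n ltnS; apply: le_truncn.
  rewrite ler_pM2r ?invr_gt0//.
  by have := gM x Dx; rewrite ler_norml => /andP[_]; lra.
move=> g'; rewrite in_cons => /predU1P[->|]; last exact: gy.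
have [Dy yx] := ED _ _ yE.
have := cellP x Dx; have := cellP y Dy; rewrite yx.
rewrite !ler_pdivlMr// !ltr_pdivrMr// -natr1 mulrDl mul1r.
by rewrite ltr_norml => /andP[? ?] /andP[? ?]; apply/andP; split; lra.
Qed.

End FiniteNet.

(** * Agreement on relatively countably compact sets *)

Section Agreement.
Context {R : realType} {X : topologicalType}.
Implicit Types (f g h : X -> R) (D : set X) (U W : set (X -> R)).

Variable P : set (X -> R).
Hypotheses (Pcont : forall g, P g -> continuous g) (Pfc : feebly_compact P).
Hypothesis Pbd : bounded_at_points P.

Let approximable_P g : P g -> approximable P g.
Proof. by move=> Pg E e e0; exists g => //; exact: close_refl. Qed.

(** Take [u], [v] more than [e] apart at [x] but within [e / 16] of [u0] on a net, and [y] in the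
    net close to [x] for [gs]. Since [u y] and [v y] are less than [e / 8] apart, [u] or [v] varies
    by more than [7 / 16 * e] between [x] and [y]; nearby functions still vary by [e / 4]. *)
Lemma oscillation_step D U (gs : seq (X -> R)) (e r : R) :
  relatively_countably_compact D -> relatively_open P U -> U !=set0 ->
  (forall U', relatively_open P U' -> U' !=set0 -> U' `<=` U ->
    exists u v x, [/\ U' u, U' v, D x & e < `|u x - v x|]) ->
  (forall g, g \in gs -> P g) -> 0 < e -> 0 < r ->
  exists U' x y, [/\ relatively_open P U' /\ U' !=set0, U' `<=` U, D x /\ D y,
    forall g, g \in gs -> `|g x - g y| < r &
    forall u, U' u -> e / 4 <= `|u x - u y|].
Proof.
move=> cD oU [u0 Uu0] osc gsP e0 r0.
have [g ggs|E [ED Enet]] := finite_net (gs := gs) (D := D) _ r0.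
  exact: (approximable_bounded Pcont Pfc cD (approximable_P (gsP _ ggs))).
have e160 : 0 < e / 16 by rewrite divr_gt0.
pose B F w := U `&` (P `&` [set g | close F (e / 16) g w]).
have oB F w : relatively_open P (B F w).
  by apply: relatively_openI => //; exact: relatively_open_close.
have Bw F w : U w -> B F w w.
  by move=> Uw; split=> //; split; [exact: oU.1|exact: close_refl].
have [||u [v [x [[Uu [_ uu0]] [Uv [_ vu0]] Dx uvx]]]] // := osc (B E u0) (oB _ _).
- by exists u0; exact: Bw.
- by move=> ? [].
have [y yE gy] := Enet x Dx.
have [w [Uw wxy]] : exists w, U w /\ 7 / 16 * e < `|w x - w y|.
  have [uxy|uxy] := ltP (7 / 16 * e) `|u x - u y|; first by exists u.
  exists v; split=> //; have := uu0 y yE; have := vu0 y yE.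
  have := dist_triangle3 (u x) (v x) (u y) (v y).
  rewrite (distrC (v y) (v x)); move: uxy uvx.
  have := dist_triangle3 (u y) (v y) (u0 y) (u0 y).
  rewrite subrr normr0 (distrC (u0 y) (v y)); lra.
exists (B [:: x; y] w), x, y; split=> //.
- by split=> //; exists w; exact: Bw.
- by move=> ? [].
- by split=> //; exact: ED.
move=> z [_ [_ zw]].
have := zw x (mem_head _ _); have := zw y; rewrite in_cons mem_head orbT => /(_ isT).
have := dist_triangle3 (w x) (w y) (z x) (z y); rewrite (distrC (w x) (z x)).
by move: wxy; lra.
Qed.

(** Otherwise iterating [oscillation_step] gives points [d n], [d' n] that all earlier functions
    nearly identify and all later ones separate by [e / 4], against the double limit property. *)
Lemma small_diameter D W (e : R) :
  relatively_countably_compact D -> relatively_open P W -> W !=set0 -> 0 < e ->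
  exists U, [/\ relatively_open P U, U !=set0, U `<=` W &
    forall u v x, U u -> U v -> D x -> `|u x - v x| <= e].
Proof.
move=> cD oW W0 e0; apply: contrapT => noU.
have osc U : relatively_open P U -> U !=set0 -> U `<=` W ->
    exists u v x, [/\ U u, U v, D x & e < `|u x - v x|].
  move=> oU U0 UW; apply: contrapT => nosc; apply: noU; exists U; split=> //.
  move=> u v x Uu Uv Dx; rewrite leNgt; apply/negP => uvx; apply: nosc.
  by exists u, v, x.
have [w0 Ww0] := W0; have [_ [_ [x0 _]]] := osc W oW W0 (fun _ => id).
pose state := (set (X -> R) * seq (X -> R) * (X -> R) * X * X)%type.
pose inv (s : state) := let: (U, gs, _, _, _) := s in
  [/\ relatively_open P U, U !=set0, U `<=` W & forall g, g \in gs -> P g].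
pose next (s s' : state) :=
  let: (U, gs, _, _, _) := s in let: (U', gs', g', x, y) := s' in
  [/\ U' `<=` U, U' g', gs' = g' :: gs &
   [/\ D x, D y, forall g, g \in gs -> `|g x - g y| < (size gs).+1%:R^-1 &
   forall u, U' u -> e / 4 <= `|u x - u y|]].
(* The step must be total, so a state violating [inv] is sent to itself. *)
have step s : {s' | inv s -> inv s' /\ next s s'}.
  apply/cid; have [sI|?] := pselect (inv s); last by exists s.
  case: s sI => [[[[U gs] g] x] y] [oU U0 UW gsP].
  have r0 : 0 < (size gs).+1%:R^-1 :> R by rewrite invr_gt0.
  have [|U' [x' [y' [[oU' U'0] U'U [Dx' Dy'] gsxy U'xy]]]] :=
    oscillation_step cD oU U0 _ gsP e0 r0.
    by move=> V oV V0 VU; apply: osc => // ? /VU/UW.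
  have [g' U'g'] := U'0.
  exists (U', g' :: gs, g', x', y') => _; split; last by [].
  split=> //; first by move=> ? /U'U/UW.
  by move=> ?; rewrite in_cons => /predU1P[->|/gsP//]; exact: oU'.1.
have [s [s0 sS]] := dependent_choice step (W, [::], w0, x0, x0).
have sI n : inv (s n).
  by elim: n => [|n /sS[]//]; rewrite s0; split.
have {sS} sS n : next (s n) (s n.+1) by have /(_ (sI n))[] := sS n.
pose U n := (s n).1.1.1.1; pose gs n := (s n).1.1.1.2; pose g n := (s n.+1).1.1.2.
pose d n := (s n.+1).1.2; pose d' n := (s n.+1).2.
have {sI} sI n : [/\ relatively_open P (U n), U n !=set0, U n `<=` W &
    forall g, g \in gs n -> P g].
  by have := sI n; rewrite /U /gs; case: (s n) => [[[[? ?] ?] ?] ?].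
have {sS} sS n : [/\ U n.+1 `<=` U n, U n.+1 (g n), gs n.+1 = g n :: gs n &
   [/\ D (d n), D (d' n),
    forall h, h \in gs n -> `|h (d n) - h (d' n)| < (size (gs n)).+1%:R^-1 &
   forall u, U n.+1 u -> e / 4 <= `|u (d n) - u (d' n)|]].
  have := sS n; rewrite /U /gs /g /d /d'.
  by case: (s n) => [[[[? ?] ?] ?] ?]; case: (s n.+1) => [[[[? ?] ?] ?] ?].
have gsz n : size (gs n) = n.
  elim: n => [|n IH]; first by rewrite /gs s0.
  by have [_ _ -> _] := sS n; rewrite /= IH.
have gsg i n : (i < n)%N -> g i \in gs n.
  elim: n => // n IH; rewrite ltnS leq_eqVlt => /predU1P[->|/IH];
    by have [_ _ -> _] := sS n; rewrite in_cons ?eqxx// => ->; rewrite orbT.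
have Umono n m : (n <= m)%N -> U m `<=` U n.
  elim: m => [|m IH]; first by rewrite leqn0 => /eqP->.
  rewrite leq_eqVlt => /predU1P[->//|/IH mn]; have [UU _ _ _] := sS m.
  by move=> ? /UU/mn.
have Pg i : P (g i).
  by have [_ _ _ /(_ (g i))] := sI i.+1; apply; exact: gsg.
have [f [Pf gf]] := accumulation_exists Pbd Pg.
have e80 : 0 < e / 8 by rewrite divr_gt0.
have [n|n||n fn] := double_limit Pcont Pfc cD Pg Pf gf (d := d) (d' := d') _ _ _ e80.
- by have [_ _ _ []] := sS n.
- by have [_ _ _ []] := sS n.
- move=> i r r0; have [N NP] := eventually_natSinv_lt r0.
  exists (maxn N i.+1) => n; rewrite geq_max => /andP[/NP Nn ni].
  have [_ _ _ [_ _ /(_ _ (gsg _ _ ni)) + _]] := sS n; rewrite gsz => gd.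
  exact: lt_trans Nn.
have e160 : 0 < e / 16 by rewrite divr_gt0.
have [m [_ [nm -> gm]]] := gf [:: d n; d' n] _ n e160.
have [_ _ _ [_ _ _ /(_ (g m))]] := sS n.
have Unm : U n.+1 (g m) by have [_ Ug _ _] := sS m; exact: Umono Ug.
move=> /(_ Unm); have := gm _ (mem_head _ _); have := gm (d' n).
rewrite in_cons mem_head orbT => /(_ isT).
have := dist_triangle3 (g m (d n)) (g m (d' n)) (f (d n)) (f (d' n)).
by rewrite (distrC (f (d' n))); move: fn; lra.
Qed.
Lemma small_diameters (D : nat -> set X) W (e : R) n :
  (forall j, relatively_countably_compact (D j)) ->
  relatively_open P W -> W !=set0 -> 0 < e ->
  exists U, [/\ relatively_open P U, U !=set0, U `<=` W &
    forall j u v x, (j < n)%N -> U u -> U v -> D j x -> `|u x - v x| <= e].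
Proof.
move=> cD oW W0 e0; elim: n => [|n [U [oU U0 UW Ue]]]; first by exists W; split.
have [U' [oU' U'0 U'U U'e]] := small_diameter (cD n) oU U0 e0.
exists U'; split=> // [u /U'U/UW//|j u v x].
rewrite ltnS leq_eqVlt => /predU1P[->|jn U'u U'v]; first exact: U'e.
by apply: Ue => //; exact: U'U.
Qed.

(** The net points stay inside [D j] because the double limit property is later applied to sequences
    of them. *)
Lemma finite_nets (D : nat -> set X) (gs : seq (X -> R)) (e : R) n :
  (forall j, relatively_countably_compact (D j)) ->
  (forall g, g \in gs -> approximable P g) -> 0 < e ->
  exists E : seq X, forall j x, (j < n)%N -> D j x ->
    exists y, [/\ y \in E, D j y & forall g, g \in gs -> `|g x - g y| < e].
Proof.
move=> cD gsP e0; have /choice[E EP] j : exists E : seq X,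
    (forall x, x \in E -> D j x) /\ forall x, D j x ->
    exists2 y, y \in E & forall g, g \in gs -> `|g x - g y| < e.
  apply: finite_net e0 => g /gsP Pg.
  by have [M gM] := approximable_bounded Pcont Pfc (cD j) Pg; exists M => x; exact: gM.
exists (flatten [seq E j | j <- iota 0 n]) => j x jn /(EP j).2[y yE gy].
exists y; split=> //; last exact: (EP j).1.
by apply/flattenP; exists (E j) => //; apply: map_f; rewrite mem_iota.
Qed.

(* Open sets [U n] of small diameter over [D 0], ..., [D n] are chosen close
   to [f] on finite nets [E n] of these sets for all functions chosen so far;
   their centers then converge to [f] on the whole of [D j] by the double limit
   property, so [f] agrees there with any accumulation point of the [U n]. *)
Lemma agreement_sequence f (D : nat -> set X) :
  (forall j, relatively_countably_compact (D j)) -> approximable P f ->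
  exists2 h, P h & forall j x, D j x -> h x = f x.
Proof.
move=> cD Pf.
pose state := (set (X -> R) * seq X * seq (X -> R) * (X -> R))%type.
pose inv (s : state) := forall g, g \in s.1.2 -> P g.
pose next (s s' : state) :=
  let: (_, E, gs, _) := s in let: (U', E', gs', g') := s' in
  let r := (size gs).+1%:R^-1 : R in
  [/\ gs' = g' :: gs, {subset E <= E'}, relatively_open P U', U' g' &
   [/\ forall u, U' u -> close E r u f,
    forall j u v x, (j < (size gs).+1)%N -> U' u -> U' v -> D j x ->
      `|u x - v x| <= r &
    forall j x, (j < (size gs).+1)%N -> D j x ->
      exists y, [/\ y \in E', D j y &
        forall g, g \in f :: gs' -> `|g x - g y| < r]]].
have step s : {s' | inv s -> inv s' /\ next s s'}.
  apply/cid; have [|?] := pselect (inv s); last by exists s.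
  case: s => [[[U E] gs] g] sI.
  have r0 : 0 < (size gs).+1%:R^-1 :> R by rewrite invr_gt0.
  have [g0 Pg0 g0f] := Pf E _ r0.
  have [|U' [oU' [g' U'g'] U'f U'r]] := small_diameters (size gs).+1 cD
    (relatively_open_close P E (size gs).+1%:R^-1 f) _ r0; first by exists g0.
  have gsP h : h \in g' :: gs -> P h.
    by rewrite in_cons => /predU1P[->|/sI//]; exact: oU'.1.
  have [h|E' E'P] := finite_nets (gs := f :: g' :: gs) (size gs).+1 cD _ r0.
    by rewrite in_cons => /predU1P[->//|/gsP/approximable_P].
  exists (U', E ++ E', g' :: gs, g') => _; split; first exact: gsP.
  split=> //; first by move=> x; rewrite mem_cat => ->.
  split=> // [u /U'f[]//|j x jn /(E'P j x jn)[y [yE' Dy gy]]].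
  by exists y; split=> //; rewrite mem_cat yE' orbT.
(* The initial [setT] and [f] are placeholders: [inv] concerns only the list, and [U] and [g] are
   read from index 1 on. *)
have [s [s0 sS]] := dependent_choice step (setT, [::], [::], f).
have sI n : inv (s n) by elim: n => [|n /sS[]//]; rewrite s0.
have {sS} sS n : next (s n) (s n.+1) by have /(_ (sI n))[] := sS n.
pose U n := (s n.+1).1.1.1; pose E n := (s n).1.1.2; pose gs n := (s n).1.2.
pose g n := (s n.+1).2.
have {sI} sI n : forall g, g \in gs n -> P g by exact: sI.
have {sS} sS n : let r := (size (gs n)).+1%:R^-1 : R in
  [/\ gs n.+1 = g n :: gs n, {subset E n <= E n.+1}, relatively_open P (U n),
    U n (g n) &
   [/\ forall u, U n u -> close (E n) r u f,
    forall j u v x, (j < (size (gs n)).+1)%N -> U n u -> U n v -> D j x ->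
      `|u x - v x| <= r &
    forall j x, (j < (size (gs n)).+1)%N -> D j x ->
      exists y, [/\ y \in E n.+1, D j y &
        forall h, h \in f :: gs n.+1 -> `|h x - h y| < r]]].
  have := sS n; rewrite /U /gs /g /E.
  by case: (s n) => [[[? ?] ?] ?]; case: (s n.+1) => [[[? ?] ?] ?].
have gsz n : size (gs n) = n.
  elim: n => [|n IH]; first by rewrite /gs s0.
  by have [-> _ _ _ _] := sS n; rewrite /= IH.
have gsg i n : (i < n)%N -> g i \in gs n.
  elim: n => // n IH; rewrite ltnS leq_eqVlt => /predU1P[->|/IH];
    by have [-> _ _ _ _] := sS n; rewrite in_cons ?eqxx// => ->; rewrite orbT.
have Emono n m : (n <= m)%N -> {subset E n <= E m}.
  elim: m => [|m IH]; first by rewrite leqn0 => /eqP->.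
  rewrite leq_eqVlt => /predU1P[->//|/IH nm]; have [_ EE _ _ _] := sS m.
  by move=> ? /nm/EE.
have Pg i : P (g i) by apply: (sI i.+1); exact: gsg.
have Uf n u : U n u -> close (E n) n.+1%:R^-1 u f.
  by have [_ _ _ _ []] := sS n; rewrite gsz => + _ _; apply.
have Ud n j u v x : (j <= n)%N -> U n u -> U n v -> D j x -> `|u x - v x| <= n.+1%:R^-1.
  by have [_ _ _ _ [_]] := sS n; rewrite gsz => + _; apply.
have netE n j x : (j <= n)%N -> D j x -> exists y, [/\ y \in E n.+1, D j y,
    `|f x - f y| < n.+1%:R^-1 &
    forall i, (i <= n)%N -> `|g i x - g i y| < n.+1%:R^-1].
  have [_ _ _ _ [_ _ +]] := sS n; rewrite gsz => + jn Dx.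
  move=> /(_ j x jn Dx)[y [yE Dy hy]]; exists y; split=> //.
    by apply: hy; rewrite mem_head.
  by move=> i iN; apply: hy; rewrite in_cons gsg ?orbT.
(* If convergence failed at [x], functions [g (t i)] staying [e] away from [f] at [x] would have an
   accumulation point [phi]. *)
have gf j x (e : R) : D j x -> 0 < e ->
    exists N, forall n, (N <= n)%N -> `|g n x - f x| < e.
  move=> Dx e0; apply: contrapT => /forallNP nN.
  have /choice[t tP] N : exists n, (N <= n)%N /\ e <= `|g n x - f x|.
    have /existsNP[n /not_implyP[Nn /negP]] := nN N.
    by rewrite -leNgt; exists n.
  have [phi [Pphi gphi]] := accumulation_exists Pbd (fun i => Pg (t i)).
  have e80 : 0 < e / 8 by rewrite divr_gt0.
  have [N NP] := eventually_natSinv_lt e80.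
  pose b := maxn j N.
  (* The points [y m] approach [x] as seen by [f] and every [g i]; they lie in nets, where later
     functions [g i] are close to [f]. *)
  have /choice[y yP] m : exists y, [/\ y \in E (b + m).+1, D j y,
      `|f x - f y| < e / 8 &
      forall i, (i <= b + m)%N -> `|g i x - g i y| < (b + m).+1%:R^-1].
    have [|y [yE Dy fy gy]] := netE (b + m)%N j x _ Dx.
      by rewrite (leq_trans (leq_maxl j N))// leq_addr.
    exists y; split=> //; apply: lt_trans fy (NP _ _).
    by rewrite (leq_trans (leq_maxr j N))// leq_addr.
  have e40 : 0 < e / 4 by rewrite divr_gt0.
  have [m|//|i r r0|m phim] := double_limit Pcont Pfc (cD j)
    (fun i => Pg (t i)) Pphi gphi (d := y) (d' := fun=> x) _ _ _ e40.
  - by have [] := yP m.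
  - have [N' N'P] := eventually_natSinv_lt r0.
    exists (maxn N' (t i)) => n; rewrite geq_max => /andP[N'n tn].
    have [_ _ _ /(_ (t i))] := yP n; rewrite distrC => gy.
    apply: lt_trans (gy _) (N'P _ _); first exact: leq_trans (leq_addl _ _).
    exact: leq_trans (leq_addl _ _).
  (* The path from [g (t i) x] to [f x] through [phi x], [phi (y m)], [g (t i) (y m)] and [f (y m)]
     costs four times [e / 8] and once [e / 4], less than [e]. *)
  have [i [_ [im -> gi]]] := gphi [:: x; y m] _ (b + m).+1 e80.
  have [yE _ fy _] := yP m.
  have [it] := tP i; rewrite leNgt => /negP; apply.
  have gfy : `|g (t i) (y m) - f (y m)| < e / 8.
    have yEt : y m \in E (t i) by apply: Emono yE; exact: leq_trans it.
    have [_ _ _ Ug _] := sS (t i).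
    apply: lt_trans (Uf _ _ Ug _ yEt) (NP _ _).
    apply: leq_trans it; apply: leq_trans im.
    by rewrite leqW// (leq_trans (leq_maxr j N))// leq_addr.
  have := gi x (mem_head _ _); have := gi (y m).
  rewrite in_cons mem_head orbT => /(_ isT).
  by move: phim fy gfy; rewrite !ltr_norml; lra.
have [n|h Ph hU] := Pfc (U := U).
  by have [_ _ oU Ug _] := sS n; split=> //; exists (g n).
exists h => // j x Dx; apply: dist_lt_eq => e e0.
(* One third each for the diameter of [U n] at [x], the convergence of [g n x] and the accumulation
   at [h]. *)
have e30 : 0 < e / 3 by rewrite divr_gt0.
have [N1 N1P] := eventually_natSinv_lt e30; have [N2 N2P] := gf j x _ Dx e30.
have [n [u [+ Unu uh]]] := hU [:: x] _ (maxn j (maxn N1 N2)) e30.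
rewrite !geq_max => /and3P[jn N1n N2n].
have [_ _ _ Ug _] := sS n.
have := uh x (mem_head _ _); have := N2P n N2n.
have := le_lt_trans (Ud n j _ _ _ jn Unu Ug Dx) (N1P n N1n).
by rewrite !ltr_norml; lra.
Qed.

(** Unlike in [Pc], the sets [D n] may leave [L], so the property passes to subsets as well as to
    countable unions. *)
Definition sigma_relatively_countably_compact (L : set X) :=
  exists D : nat -> set X, (forall n, relatively_countably_compact (D n)) /\
    L `<=` closure (\bigcup_n D n).

Lemma relatively_countably_compact1 (x : X) : relatively_countably_compact [set x].
Proof.
move=> u ux; exists x => B C [N _ uB] xC; exists (u N); split.
  exact: (uB N (leqnn N)).
by rewrite (ux N); exact: nbhs_singleton.
Qed.

(** [h] equals [f] on the sets [D n]. For [x] in the closure of their union, a second function,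
    equal to [f] there and also at [x], agrees with [h] at [x] by continuity. *)
Lemma agreement f (L : set X) : sigma_relatively_countably_compact L ->
  approximable P f -> exists2 h, P h & forall x, L x -> h x = f x.
Proof.
move=> [D [cD LD]] Pf; have [h Ph hf] := agreement_sequence cD Pf.
exists h => // x Lx.
have [[|j]|h' Ph' h'f] :=
    @agreement_sequence f (fun n => if n is k.+1 then D k else [set x]) _ Pf.
- exact: relatively_countably_compact1.
- exact: cD.
rewrite -(h'f 0%N x erefl); apply: dist_lt_eq => e e0.
have e20 : 0 < e / 2 by rewrite divr_gt0.
have ch := Pcont Ph; have ch' := Pcont Ph'.
have /cvgrPdist_lt/(_ _ e20) hx := ch x.
have /cvgrPdist_lt/(_ _ e20) h'x := ch' x.
have [y [[j _ Dy] [hy h'y]]] := LD x Lx _ (filterI hx h'x).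
move: hy h'y; rewrite /= (hf j y Dy) (h'f j.+1 y Dy) !ltr_norml; lra.
Qed.

End Agreement.

(** * Weakly countably pracompact sets, their subsets and countable unions *)

Section CountablyPracompact.
Context {X : topologicalType}.

Lemma relatively_countably_compact_image (Y Z : topologicalType) (p : Y -> Z)
    (D : set Y) :
  continuous p -> relatively_countably_compact D ->
  relatively_countably_compact (p @` D).
Proof.
move=> cp cD u up.
have /choice[v /all_and2[Dv pv]] n : exists y, D y /\ p y = u n.
  by have [y] := up n; exists y.
have [y vy] := cD v Dv; exists (p y) => B C uB /(cp y) yC.
have [|z [vz Cz]] := vy (p @^-1` B) (p @^-1` C) _ yC; last by exists (p z).
by move: uB; rewrite /= !nbhs_simpl; apply: filterS => n; rewrite /= pv.
Qed.

Lemma Pc_sigma_relatively_countably_compact (L : set X) :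
  Pc L -> sigma_relatively_countably_compact L.
Proof.
move=> [F [dF pF]].
pose D n := sval (cid (pF n)).
have dD n : dense (D n) := (svalP (cid (pF n))).1.
have cD n : relatively_countably_compact (D n) := (svalP (cid (pF n))).2.
have cval (Y : topologicalType) (A : set Y) : continuous (fun y : set_type A => \val y).
  exact: (@initial_continuous _ _ set_val).
exists (fun n => (fun y => \val y) @` ((fun y => \val y) @` D n)); split.
  move=> n; apply: relatively_countably_compact_image; first exact: cval.
  by apply: relatively_countably_compact_image; [exact: cval|exact: cD].
move=> x Lx B; rewrite nbhsE => -[G [oG Gx] GB].
have Lx' : x \in L by rewrite inE.
have oG' : open ((fun y : set_type L => \val y) @^-1` G).
  by apply: open_comp => // ? _; exact: cval.
have [|y [Gy [n _ Fy]]] := dF _ _ oG'; first by exists (exist _ x Lx').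
have Fy' : y \in F n by rewrite inE.
have oG'' : open ((fun y : set_type (F n) => \val (\val y)) @^-1` G).
  apply: (open_comp (f := fun y : set_type (F n) => \val y)) oG' => // ? _.
  exact: cval.
have [|z [Gz Dz]] := dD n _ _ oG''; first by exists (exist _ y Fy').
exists (\val (\val z)); split; last exact: GB.
by exists n => //; exists (\val z) => //; exists z.
Qed.

Lemma sub_sigma_relatively_countably_compact (L L' : set X) : L `<=` L' ->
  sigma_relatively_countably_compact L' -> sigma_relatively_countably_compact L.
Proof. by move=> LL' [D [cD DL]]; exists D; split=> // x /LL'/DL. Qed.

Lemma bigcup_sigma_relatively_countably_compact (L : nat -> set X) :
  (forall n, sigma_relatively_countably_compact (L n)) ->
  sigma_relatively_countably_compact (\bigcup_n L n).
Proof.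
move=> /choice[D /all_and2[cD DL]].
exists (fun m => let: (i, j) := odflt (0, 0)%N (unpickle m) in D i j); split.
  by move=> m; case: (odflt _ _) => i j; exact: cD.
move=> x [i _ /DL Dx]; apply: closureS Dx => y [j _ Dy].
by exists (pickle (i, j)) => //; rewrite pickleK.
Qed.

Lemma set1_sigma_relatively_countably_compact (x : X) :
  sigma_relatively_countably_compact [set x].
Proof.
exists (fun=> [set x]); split=> [_|y yx]; first exact: relatively_countably_compact1.
by apply: subset_closure; exists 0%N.
Qed.

Lemma setU_sigma_relatively_countably_compact (L L' : set X) :
  sigma_relatively_countably_compact L -> sigma_relatively_countably_compact L' ->
  sigma_relatively_countably_compact (L `|` L').
Proof.
move=> sL sL'; have -> : L `|` L' = \bigcup_n (if n is 0%N then L else L').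
  apply/seteqP; split=> [x [Lx|Lx]|x [[|n] _ Lx]];
    by [exists 0%N|exists 1%N|left|right].
by apply: bigcup_sigma_relatively_countably_compact => -[].
Qed.

End CountablyPracompact.

(** * The game *)

Section Game.
Context {R : realType} {X : topologicalType}.

Variable P : set (X -> R).
Hypotheses (Pcont : forall g, P g -> continuous g) (Pfc : feebly_compact P).
Hypothesis Pbd : bounded_at_points P.

Let agreement_P := agreement Pcont Pfc Pbd.

(* Answering the sets [S k] by functions of [P] that agree with [f] at [x] and
   on the earlier [S k], and playing the neighborhoods where these functions
   are close to [f x], wins: a suitable accumulation point of these functions
   is equal to [f x] on [\bigcap_n V n] and to [f] on every [S k]. *)
Lemma beta_winning_strategy (f : X -> R) (A : set X) (x : X) :
  approximable P f -> ~ closure (f @` A) (f x) ->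
  exists sigma, beta_strategy x sigma /\ beta_winning R A (@Pc X) sigma.
Proof.
move=> Pf fx.
have [e e0 fAe] : exists2 e : R, 0 < e & forall a, A a -> e <= `|f a - f x|.
  apply: contrapT => noe; apply: fx => B /nbhs_ballP[e /= e0 eB].
  apply: contrapT => AB; apply: noe; exists e => // a Aa.
  rewrite leNgt; apply/negP => ae; apply: AB; exists (f a); split; first by exists a.
  by apply: eB; rewrite /ball /= distrC.
(* The default value for [xget] must already agree with [f] at [x], hence the constant sequence. *)
have [h0 Ph0 h0x] := approximable_countable Pfc (fun=> x) Pf.
pose agrees (hist : seq (set X * set X)) h := [/\ P h, h x = f x &
  forall k y, (k < size hist)%N -> (nth (set0, set0) hist k).2 y -> h y = f y].
pose H hist := xget h0 (agrees hist).
have HP hist : P (H hist) /\ H hist x = f x.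
  by rewrite /H; case: xgetP => [h _ []|_]; split=> //; exact: h0x 0%N.
(* The functions of all prefixes constrain each move, with tolerance tending to 0; on the
   intersection of the moves each then equals its value at [x]. *)
pose sigma hist := [set y | forall k, k \in iota 0 (size hist).+1 ->
  `|H (take k hist) y - H (take k hist) x| < (size hist).+1%:R^-1].
exists sigma; split.
  move=> hist; apply: (near_close (X := nat)); last by rewrite invr_gt0.
  by move=> k; apply: Pcont; exact: (HP _).1.
move=> V S Vsigma Slegal [S' [S'V [L' PcL' S'L'] nsep]].
have sS n : sigma_relatively_countably_compact (S n).
  have [_ [L PcL SL]] := Slegal n; apply: sub_sigma_relatively_countably_compact SL _.
  exact: Pc_sigma_relatively_countably_compact.
pose h n := H (history V S n).
have hP n : agrees (history V S n) (h n).
  have [|g Pg gf] := @agreement_P f (x |` \bigcup_(k in `I_n) S k) _ Pf.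
    apply: (@sub_sigma_relatively_countably_compact _ _ (x |` \bigcup_k S k)).
      by apply: setUS => y [k _ Sky]; exists k.
    apply: setU_sigma_relatively_countably_compact.
      exact: set1_sigma_relatively_countably_compact.
    exact: bigcup_sigma_relatively_countably_compact.
  apply: (xgetPex h0); exists g; split=> //; first by apply: gf; left.
  move=> k y; rewrite size_mkseq => kn; rewrite nth_mkseq// => Sky.
  by apply: gf; right; exists k.
have hS n k y : (k < n)%N -> S k y -> h n y = f y.
  move=> kn Sky; have [_ _ /(_ k y)] := hP n; apply; first by rewrite size_mkseq.
  by rewrite nth_mkseq.
have hS' n y : S' y -> h n y = f x.
  move=> /S'V Vy; have [_ <- _] := hP n; apply: dist_lt_eq => r r0.
  have [N NP] := eventually_natSinv_lt r0.
  have := Vy (maxn n N) I; rewrite Vsigma => /(_ n); rewrite size_mkseq.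
  have -> : take n (history V S (maxn n N)) = history V S n.
    by rewrite /history /mkseq -map_take take_iota (minn_idPl (leq_maxl _ _)).
  rewrite mem_iota ltnS leq_maxl => /(_ isT) hr; apply: lt_trans hr (NP _ _).
  exact: leq_maxr.
have [n|phi [Pphi hphi]] := accumulation_exists Pbd (g := h).
  by have [] := hP n.
(* Separation needs a continuous function, so [phi] is replaced by an element of [P] equal to it on
   [S'] and every [S n]. *)
have [|g Pg gphi] := @agreement_P phi (S' `|` \bigcup_n S n) _ Pphi.
  apply: setU_sigma_relatively_countably_compact.
    apply: sub_sigma_relatively_countably_compact S'L' _.
    exact: Pc_sigma_relatively_countably_compact.
  exact: bigcup_sigma_relatively_countably_compact.
have gS' y : S' y -> g y = f x.
  move=> S'y; rewrite gphi; last by left.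
  apply: dist_lt_eq => r r0.
  have [n [_ [_ -> /(_ y (mem_head _ _))]]] := hphi [:: y] _ 0%N r0.
  by rewrite hS'// distrC.
have gS n y : S n y -> g y = f y.
  move=> Sny; rewrite gphi; last by right; exists n.
  apply: dist_lt_eq => r r0.
  have [m [_ [nm -> /(_ y (mem_head _ _))]]] := hphi [:: y] _ n.+1 r0.
  by rewrite (hS _ n)// distrC.
(* This is 0 on [S'] and 1 on each [S n], where [f] is at least [e] from [f x]. *)
apply: nsep; exists (fun y => Num.min 1 (`|g y - f x| / e)); split.
- move=> y; apply: (@continuous_min R X (cst 1)); first exact: cst_continuous.
  apply: (@continuousM R X _ (cst e^-1)); last exact: cst_continuous.
  apply: (@continuous_comp _ R R (fun t => g t - f x) Num.norm).
    apply: (@continuousB R R^o _ _ (cst (f x))); last exact: cst_continuous.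
    exact: Pcont.
  exact: (@norm_continuous _ R^o).
- move=> _ [y _ <-]; rewrite /= in_itv /= ge_min lexx le_min ler01/= andbT.
  by rewrite divr_ge0// ltW.
- by move=> _ [y S'y <-] /=; rewrite gS'// subrr normr0 mul0r min_r.
- move=> _ [y [n _ Sny] <-] /=; rewrite (gS n)// min_l// ler_pdivlMr// mul1r.
  by apply: fAe; exact: (Slegal n).1.
Qed.

End Game.

(** * Compactness of closures in the function space *)

Theorem theorem11 (R : realType) (X : topologicalType)
    (tychX : tychonoff_space X) (wcX : wc_qf_space R X) :
  mu_pc_sharp_complete R X.
Proof.
move=> Z [P [ZP cP]].
pose PF := functions_of P.
have PFcont g : PF g -> continuous g by move=> [g' _ <-]; exact: cts_fun.
have PFfc : feebly_compact PF := pseudocompact_feebly_compact cP.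
have PFbd : bounded_at_points PF := pseudocompact_bounded_at_points cP.
have cont f : approximable PF f -> continuous f.
  move=> Pf; apply: contrapT => /wcX[A [x [_ _ fx unf]]].
  by apply: unf; exact: beta_winning_strategy Pf fx.
have clZ g E (e : R) : closure Z g -> 0 < e ->
    exists2 h, PF h & close E e h (g : continuousType X R).
  move=> Zg e0.
  have := near_close E (nbhs_filter g) (fun x => @Cp_eval_continuous R X x g) e0.
  by move=> /Zg[h [/ZP Ph hg]]; exists (h : continuousType X R) => //; exists h.
rewrite compact_ultra => F UF FZ.
have /choice[f Ff] x : exists a : R, (g : continuousType X R) x @[g --> F] --> a.
  have [M PM] := PFbd x.
  (* At [x], elements of the closure of [Z] are within 1 of elements of [PF], hence the bound
     [M + 1]. *)
  apply: (@ultra_bounded_cvg _ _ F _ (M + 1)); apply: filterS FZ => g Zg /=.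
  have [h /PM hM hg] := clZ g [:: x] 1 Zg ltr01.
  have := hg x (mem_head _ _); move: hM; rewrite ltr_norml !ler_norml; lra.
have Pf : approximable PF f.
  move=> E e e0; have e20 : 0 < e / 2 by rewrite divr_gt0.
  have [g [Zg gf]] := filter_ex (filterI FZ (near_close E _ Ff e20)).
  have [h Ph hg] := clZ g E _ Zg e20; exists h => //.
  by rewrite [e]splitr; exact: close_trans hg gf.
pose fc : Cp R X := mkcts (cont f Pf).
have Ffc : F --> fc.
  move=> B [/= _ [[G oG <-] Gfc GB]].
  have FG : {ptws, (fun g : continuousType X R => (g : X -> R)) @ F --> f}.
    by apply/pointwise_cvgP => x; exact: Ff.
  have FfG : F [set g : Cp R X | G ((g : continuousType X R) : X -> R)].
    exact: (FG G (open_nbhs_nbhs (conj oG Gfc))).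
  by apply: (filterS _ FfG) => g; exact: GB.
exists fc; split=> //.
by apply: closed_closure => B /Ffc FB; exact: filter_ex (filterI FZ FB).
Qed.
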